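(* Let $f_i:\mathbb{R}^{n_i}\to[0,\infty)$ ($1\le i\le N$) and $g_j:\mathbb{R}^{m_j}\to[0,\infty)$ ($1\le j\le M$) be smooth, let $U=(u_{i,j})$ be a real $N\times M$ matrix, and assume that the zero-sum bilinear game with payoff matrix $U$ has a fully mixed Nash equilibrium $(p,q)$. Consider the system $$\dot{\theta}_i=-\nabla f_i(\theta_i)\Big(\sum_{j=1}^M u_{i,j}g_j(\phi_j)+\lambda\Big),\qquad \dot{\phi}_j=\nabla g_j(\phi_j)\Big(\sum_{i=1}^N u_{i,j}f_i(\theta_i)+\mu\Big),$$ $$\dot{\mu}=-\Big(\sum_{j=1}^M g_j(\phi_j)-1\Big),\qquad \dot{\lambda}=\sum_{i=1}^N f_i(\theta_i)-1 .$$ Assume that $(\theta(0),\phi(0),\lambda(0),\mu(0))$ is a safe initialization. Then there exist $\lambda^*,\mu^*\in\mathbb{R}$ such that, along the solution with this initialization, writing $f_i=f_i(\theta_i(t))$, $g_j=g_j(\phi_j(t))$, $\lambda=\lambda(t)$, $\mu=\mu(t)$, the quantity $$H=\sum_{i=1}^N\int_{p_i}^{f_i}\frac{z-p_i}{\|\nabla f_i(X_{\theta_i(0)}(z))\|^2}\,dz+\sum_{j=1}^M\int_{q_j}^{g_j}\frac{z-q_j}{\|\nabla g_j(X_{\phi_j(0)}(z))\|^2}\,dz+\int_{\lambda^*}^{\lambda}(z-\lambda^* )\,dz+\int_{\mu^*}^{\mu}(z-\mu^* )\,dz$$ is constant in time.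
   Context: Here $\theta=(\theta_1,\dots,\theta_N)$, $\phi=(\phi_1,\dots,\phi_M)$ with $\theta_i\in\mathbb{R}^{n_i}$, $\phi_j\in\mathbb{R}^{m_j}$, and $\lambda,\mu\in\mathbb{R}$ are Lagrange multipliers. The system is continuous-time gradient-descent-ascent for $\min_{\theta,\mu}\max_{\phi,\lambda}\ F(\theta)^\top U G(\phi)+\lambda(\sum_i f_i(\theta_i)-1)+\mu(\sum_j g_j(\phi_j)-1)$ with $F=(f_i)_i$, $G=(g_j)_j$. A fully mixed Nash equilibrium $(p,q)$ of the game $U$ is a pair of probability vectors $p\in\mathbb{R}^N$, $q\in\mathbb{R}^M$ with all entries strictly positive such that $p$ minimizes $x\mapsto x^\top Uq$ over probability vectors $x$ and $q$ maximizes $y\mapsto p^\top Uy$ over probability vectors $y$. The gradient ascent flows of all $f_i$ and $g_j$ are assumed to be defined for all times. For each $i$, let $\gamma_i:\mathbb{R}\to\mathbb{R}^{n_i}$ solve $\dot\gamma_i=\nabla f_i(\gamma_i)$, $\gamma_i(0)=\theta_i(0)$. Define $f_{i,\theta_i(0)}=\{f_i(\gamma_i(s)):s\in\mathbb{R}\}$ and $X_{\theta_i(0)}:f_{i,\theta_i(0)}\to\mathbb{R}^{n_i}$ by $X_{\theta_i(0)}(f_i(\gamma_i(s)))=\gamma_i(s)$. $g_{j,\phi_j(0)}$ and $X_{\phi_j(0)}$ are defined in the same way from $g_j$ and $\phi_j(0)$. The initialization is called safe if, for all $i,j$, $\theta_i(0)$ is not a stationary point of $f_i$, $\phi_j(0)$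 is not a stationary point of $g_j$, $p_i\in f_{i,\theta_i(0)}$ and $q_j\in g_{j,\phi_j(0)}$. *)

(* Defs.v *)
From HB Require Import structures.
From mathcomp Require Import all_boot all_order all_algebra.
From mathcomp Require Import all_classical all_reals all_analysis.

Set Implicit Arguments.
Unset Strict Implicit.
Unset Printing Implicit Defensive.

Import Order.TTheory GRing.Theory Num.Theory.
Import numFieldNormedType.Exports.

Local Open Scope classical_set_scope.
Local Open Scope ring_scope.

Section Calculus.
Context {R : realType}.

(* In finite dimension [f] is C^(k+1) iff it is Frechet differentiable
   everywhere and all its directional derivatives are C^k. *)
Fixpoint Ck (n k : nat) (f : 'rV[R]_n -> R) : Prop :=
  match k with
  | 0%N => continuous f
  | k'.+1 => (forall x, differentiable f x) /\
             (forall v : 'rV[R]_n, Ck k' ('D_v f))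
  end.

Definition smooth (n : nat) (f : 'rV[R]_n -> R) : Prop := forall k, Ck k f.

Definition grad (n : nat) (f : 'rV[R]_n -> R) (x : 'rV[R]_n) : 'rV[R]_n :=
  \row_(k < n) 'D_(delta_mx 0 k) f x.

(* The library norm [`|v|] on ['rV_n] is the sup norm. *)
Definition enorm (n : nat) (v : 'rV[R]_n) : R :=
  Num.sqrt (\sum_(k < n) v 0 k ^+ 2).

Definition oriented_integral (a b : R) (h : R -> R) : R :=
  if a <= b then \int[lebesgue_measure]_(z in `[a, b]) h z
  else - \int[lebesgue_measure]_(z in `[b, a]) h z.

Definition stationary (n : nat) (f : 'rV[R]_n -> R) (x : 'rV[R]_n) : Prop :=
  grad f x = 0.

Definition gradient_curve (n : nat) (f : 'rV[R]_n -> R) (x : 'rV[R]_n)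
    (gamma : R -> 'rV[R]_n) : Prop :=
  gamma 0 = x /\ forall s : R, is_derive s (1 : R) gamma (grad f (gamma s)).

Definition complete_gradient_flow (n : nat) (f : 'rV[R]_n -> R) : Prop :=
  forall x, exists gamma, gradient_curve f x gamma.

Definition orbit_values (n : nat) (f : 'rV[R]_n -> R)
    (gamma : R -> 'rV[R]_n) : set R :=
  [set f (gamma s) | s in setT].

(* The map [f (gamma s) |-> gamma s]. It is unambiguous when [gamma] is a
   gradient curve from a non-stationary point, since [f \o gamma] is then
   strictly increasing; [get] selects the parameter [s]. Values of [z] outside
   [orbit_values f gamma] are irrelevant. *)
Definition orbit_point (n : nat) (f : 'rV[R]_n -> R)
    (gamma : R -> 'rV[R]_n) (z : R) : 'rV[R]_n :=
  gamma (get [set s : R | f (gamma s) = z]).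

End Calculus.

Section Game.
Context {R : realType} {N M : nat}.

Definition prob_vector (k : nat) (x : 'cV[R]_k) : Prop :=
  (forall i, 0 <= x i 0) /\ \sum_(i < k) x i 0 = 1.

(* The row player pays [payoff], so it minimizes. *)
Definition payoff (U : 'M[R]_(N, M)) (x : 'cV[R]_N) (y : 'cV[R]_M) : R :=
  (x^T *m U *m y) 0 0.

Definition fully_mixed_nash (U : 'M[R]_(N, M))
    (p : 'cV[R]_N) (q : 'cV[R]_M) : Prop :=
  [/\ prob_vector p /\ (forall i, 0 < p i 0),
      prob_vector q /\ (forall j, 0 < q j 0),
      forall x, prob_vector x -> payoff U p q <= payoff U x q &
      forall y, prob_vector y -> payoff U p y <= payoff U p q].

End Game.

Section Dynamics.
Context {R : realType} {N M : nat} {n : 'I_N -> nat} {m : 'I_M -> nat}.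
Variables (f : forall i, 'rV[R]_(n i) -> R) (g : forall j, 'rV[R]_(m j) -> R).

Definition safe_initialization (p : 'cV[R]_N) (q : 'cV[R]_M)
    (theta0 : forall i, 'rV[R]_(n i)) (phi0 : forall j, 'rV[R]_(m j))
    (gamma : forall i, R -> 'rV[R]_(n i))
    (delta : forall j, R -> 'rV[R]_(m j)) : Prop :=
  [/\ forall i, ~ stationary (@f i) (theta0 i),
      forall j, ~ stationary (@g j) (phi0 j),
      forall i, orbit_values (@f i) (gamma i) (p i 0) &
      forall j, orbit_values (@g j) (delta j) (q j 0)].

(* [J] is meant to be an open interval; the curves are arbitrary off [J]. *)
Definition gda_solution (U : 'M[R]_(N, M)) (J : set R)
    (theta : forall i, R -> 'rV[R]_(n i)) (phi : forall j, R -> 'rV[R]_(m j))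
    (lambda mu : R -> R) : Prop :=
  forall t, J t ->
  [/\ forall i, is_derive t (1 : R) (theta i)
        (- ((\sum_(j < M) U i j * g (phi j t) + lambda t) *:
             grad (@f i) (theta i t))),
      forall j, is_derive t (1 : R) (phi j)
        ((\sum_(i < N) U i j * f (theta i t) + mu t) *:
             grad (@g j) (phi j t)),
      is_derive t (1 : R) mu (- (\sum_(j < M) g (phi j t) - 1)) &
      is_derive t (1 : R) lambda (\sum_(i < N) f (theta i t) - 1)].

Definition energy (p : 'cV[R]_N) (q : 'cV[R]_M)
    (gamma : forall i, R -> 'rV[R]_(n i))
    (delta : forall j, R -> 'rV[R]_(m j)) (lambdas mus : R)
    (theta : forall i, R -> 'rV[R]_(n i)) (phi : forall j, R -> 'rV[R]_(m j))
    (lambda mu : R -> R) (t : R) : R :=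
  \sum_(i < N) oriented_integral (p i 0) (f (theta i t))
     (fun z => (z - p i 0) /
        enorm (grad (@f i) (orbit_point (@f i) (gamma i) z)) ^+ 2)
  + \sum_(j < M) oriented_integral (q j 0) (g (phi j t))
     (fun z => (z - q j 0) /
        enorm (grad (@g j) (orbit_point (@g j) (delta j) z)) ^+ 2)
  + oriented_integral lambdas (lambda t) (fun z => z - lambdas)
  + oriented_integral mus (mu t) (fun z => z - mus).

End Dynamics.

(* Main.v *)
Require Import Defs.
From HB Require Import structures.
From mathcomp Require Import all_boot all_order all_algebra.
From mathcomp Require Import all_classical all_reals all_analysis.
From mathcomp Require Import ring lra.

Set Implicit Arguments.
Unset Strict Implicit.
Unset Printing Implicit Defensive.

Import Order.TTheory GRing.Theory Num.Theory.
Import numFieldNormedType.Exports.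

Local Open Scope classical_set_scope.
Local Open Scope ring_scope.

(** The energy is a sum of one term per player strategy and two quadratic terms
in the multipliers, and its time derivative vanishes identically.

The curve [theta i] follows the direction of the gradient of [f i], with a
scalar speed [c] that depends on all the other unknowns.  It is therefore a
reparametrization of the gradient curve [gamma i]: the curves [theta i] and
[gamma i] composed with a primitive of [c] solve the same equation
[x' = c t *: grad (f i) x] with the same initial value, and the gradient of a
smooth function is Lipschitz on balls, so that Gronwall's inequality identifies
them ([ode_unique], [theta_on_orbit]).  In particular the point [theta i t] is
recovered from the number [f i (theta i t)] by [orbit_point], because [f i] is
strictly increasing along the orbit of a non-stationary point.

Consequently [f i (theta i t)] has derivative [c t * enorm (grad ...) ^+ 2], in
which the squared norm is exactly the denominator of the integrand of the
energy at the upper bound.  By the fundamental theorem of calculus the term of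
player [i] has derivative [(f i (theta i t) - p i 0) * c t]
([is_derive_player_energy]), and likewise for [phi j] and [g j], with the speed of
opposite sign; continuity of the integrand is the continuity of
the inverse of [f i \o gamma i] on its open range.

At a fully mixed equilibrium every pure strategy is a best response, so that
all the entries of [U *m q] and of [p^T *m U] equal the value [v] of the game
([fully_mixed_nash_const]).  With both reference multipliers equal to [- v],
each speed becomes linear in the deviations from equilibrium; the bilinear
contributions of the two players are opposite, and the rest is compensated by
the multiplier terms ([energy_cancel]). *)

(** * Derivatives along curves *)

Section Curves.
Context {R : realType}.

Lemma is_derive_comp_grad n (F : 'rV[R]_n -> R) (a : R -> 'rV[R]_n) t v :
  differentiable F (a t) -> is_derive t (1 : R) a v ->
  is_derive t (1 : R) (F \o a) (\sum_(k < n) grad F (a t) 0 k * v 0 k).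
Proof.
move=> dF [da <-].
have da' : differentiable a t by apply/derivable1_diffP.
have dFa : differentiable (F \o a) t by exact: differentiable_comp.
apply: DeriveDef; first exact: diff_derivable.
rewrite deriveE// diff_comp//= (deriveE _ da').
rewrite [X in 'd F _ X]row_sum_delta linear_sum/=.
by apply: eq_bigr => k _; rewrite linearZ/= /grad mxE deriveE// mulrC.
Qed.

Lemma is_derive_coord n (a : R -> 'rV[R]_n) t v k :
  is_derive t (1 : R) a v -> is_derive t (1 : R) (fun s => a s 0 k) (v 0 k).
Proof.
move=> [da <-]; apply: DeriveDef; first by have /derivable_mxP := da; exact.
by rewrite derive_mx// mxE.
Qed.

Lemma is_derive_continuous (V : normedModType R) (a : R -> V) t v :
  is_derive t (1 : R) a v -> {for t, continuous a}.
Proof.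
by move=> [da _]; apply/differentiable_continuous/derivable1_diffP.
Qed.

Lemma is_derive_comp_curve (V : normedModType R) (a : R -> V) (S : R -> R)
    t v ds :
  is_derive (S t) (1 : R) a v -> is_derive t (1 : R) S ds ->
  is_derive t (1 : R) (a \o S) (ds *: v).
Proof.
move=> [da <-] [dS <-].
have da' : differentiable a (S t) by apply/derivable1_diffP.
have dS' : differentiable S t by apply/derivable1_diffP.
have daS : differentiable (a \o S) t by exact: differentiable_comp.
apply: DeriveDef; first exact: diff_derivable.
rewrite deriveE// diff_comp//= !deriveE//.
by rewrite -linearZ/= [_ *: _]mulr1.
Qed.

Lemma is_derive_fun_sum k (h : 'I_k -> R -> R) t (dh : 'I_k -> R) :
  (forall i, is_derive t (1 : R) (h i) (dh i)) ->
  is_derive t (1 : R) (fun s => \sum_(i < k) h i s) (\sum_(i < k) dh i).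
Proof.
move=> dhE; have -> : (fun s => \sum_(i < k) h i s) = \sum_(i < k) h i.
  by apply/funext => s; rewrite fct_sumE.
exact: is_derive_sum.
Qed.

Lemma continuous_affine_sum k (u : 'I_k -> R) (h : 'I_k -> R -> R)
    (l : R -> R) t :
  (forall i, {for t, continuous (h i)}) -> {for t, continuous l} ->
  {for t, continuous (fun s => \sum_(i < k) u i * h i s + l s)}.
Proof.
move=> ch cl; apply: continuousD => //.
apply: cvg_big => [|i _]; first exact: add_continuous.
by apply: continuousM; [exact: cvg_cst | exact: ch].
Qed.

Lemma is_derive0_constant (J : set R) (E : R -> R) : is_interval J ->
  (forall t, J t -> is_derive t (1 : R) E 0) ->
  forall s t, J s -> J t -> E s = E t.
Proof.
move=> iJ dE s t Js Jt; wlog st : s t Js Jt / s <= t.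
  by move=> H; have [/H|/ltW/H H'] := leP s t; [exact | rewrite H'].
have dEst x : x \in `[s, t]%R -> is_derive x (1 : R) E 0.
  by rewrite in_itv/= => xst; apply: dE; exact: (iJ s t).
have dEoo x : x \in `]s, t[%R -> is_derive x (1 : R) E ((fun=> 0) x).
  by move=> xst; apply: dEst; exact: subset_itv_oo_cc.
have [|x _] := MVT_segment st dEoo.
  apply: continuous_in_subspaceT => x; rewrite inE => xst.
  exact: is_derive_continuous (dEst x xst).
by rewrite mul0r => /subr0_eq.
Qed.

End Curves.

(** * Bounds on balls and segments *)

Section Bounds.
Context {R : realType}.

Lemma ler_coord_norm n (v : 'rV[R]_n) k : `|v 0 k| <= `|v|.
Proof.
by rewrite [leRHS]/Num.Def.normr/= mx_normrE; apply/bigmax_geP; right; exists (0, k).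
Qed.

Lemma compact_ball n (r : R) : compact [set x : 'rV[R]_n | `|x| <= r].
Proof.
apply: bounded_closed_compact.
  exists r; split; first exact: num_real.
  by move=> M rM x /= /le_trans; apply; exact: ltW.
by apply: (@closed_comp _ _ (fun x : 'rV[R]_n => `|x|) [set y | y <= r]);
  [move=> x _; exact: norm_continuous | exact: closed_le].
Qed.

Lemma continuous_bounded_ball n (u : 'rV[R]_n -> R) (r : R) : continuous u ->
  exists2 L, 0 <= L & forall x, `|x| <= r -> `|u x| <= L.
Proof.
move=> cu.
have cA : compact (u @` [set x : 'rV[R]_n | `|x| <= r]).
  by apply: continuous_compact; [exact: continuous_subspaceT | exact: compact_ball].
have [M [_ MA]] := compact_bounded cA.
exists (`|M| + 1) => [|x xr]; first by rewrite addr_ge0.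
apply: MA; first by rewrite (le_lt_trans (ler_norm _))// ltrDl.
by exists x.
Qed.

Lemma is_derive_segment n (x y : 'rV[R]_n) (s : R) :
  is_derive s (1 : R) (fun s => x + s *: (y - x)) (y - x).
Proof.
have h : is_derive s (1 : R) (fun s : R => s *: (y - x)) (y - x).
  have db : differentiable (fun s : R => s *: (y - x)) s.
    exact: (@differentiableZl _ _ _ id).
  apply: DeriveDef; first exact: diff_derivable.
  by rewrite deriveE// diffZl//= diff_val scale1r.
by apply: is_derive_eq; rewrite add0r.
Qed.

(** Mean value theorem on the segment from [y] to [x], which stays in the ball;
the Lipschitz constant is the sum of bounds for the partial derivatives. *)
Lemma C1_lipschitz_ball n (u : 'rV[R]_n -> R) (r : R) : Ck 1 u ->
  exists2 L, 0 <= L & forall x y, `|x| <= r -> `|y| <= r ->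
    `|u x - u y| <= L * `|x - y|.
Proof.
move=> [du cu].
have /choice[L L_P] k : exists L, 0 <= L /\
    forall x, `|x| <= r -> `|'D_(delta_mx 0 k) u x| <= L.
  by have [L ? ?] := continuous_bounded_ball r (cu (delta_mx 0 k)); exists L.
exists (\sum_(k < n) L k) => [|x y xr yr].
  by apply: sumr_ge0 => k _; have [] := L_P k.
pose b (s : R) := y + s *: (x - y).
have db s : is_derive s (1 : R) b (x - y) by exact: is_derive_segment.
have dub s : is_derive s (1 : R) (u \o b)
    (\sum_(k < n) grad u (b s) 0 k * (x - y) 0 k).
  exact: is_derive_comp_grad.
have [|s s01] := MVT_segment (@ler01 R) (fun s _ => dub s).
  by apply: continuous_subspaceT => s; exact: is_derive_continuous.
rewrite /= /b scale1r scale0r addr0 subr0 mulr1 (addrC y) subrK => ->.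
rewrite (le_trans (ler_norm_sum _ _ _))// mulr_suml ler_sum// => k _.
rewrite normrM ler_pM//; last exact: ler_coord_norm.
rewrite /grad mxE; apply: (L_P k).2.
(* As a convex combination, the intermediate point stays in the ball. *)
have -> : y + s *: (x - y) = (1 - s) *: y + s *: x.
  by rewrite scalerBl scalerBr scale1r addrA addrAC.
move: s01; rewrite in_itv/= => /andP[s0 s1].
rewrite (le_trans (ler_normD _ _))// !normrZ !ger0_norm ?subr_ge0//.
rewrite (_ : r = (1 - s) * r + s * r); last by rewrite -mulrDl subrK mul1r.
by rewrite lerD// ler_wpM2l// subr_ge0.
Qed.

(** The Gronwall argument needs a differentiable distance, whereas the Lipschitz
estimates are in the sup norm; this is the comparison between the two. *)
Lemma ler_sqr_norm_sum_sqr n (v : 'rV[R]_n) : `|v| ^+ 2 <= \sum_(k < n) v 0 k ^+ 2.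
Proof.
have [->|v0] := eqVneq v 0.
  by rewrite normr0 expr0n/= sumr_ge0// => k _; rewrite sqr_ge0.
have /mx_norm_neq0[[i k]/= vE] : `|v| != 0 by rewrite normr_eq0.
rewrite [`|v|]vE ord1 real_normK ?num_real// (bigD1 k)//= lerDl sumr_ge0// => j _.
exact: sqr_ge0.
Qed.

Lemma bounded_segment (V : normedModType R) (u : R -> V) (a b : R) :
  (forall x, x \in `[a, b]%R -> {for x, continuous u}) ->
  exists M, forall x, x \in `[a, b]%R -> `|u x| <= M.
Proof.
move=> cu; have cA : compact (u @` `[a, b]).
  apply: continuous_compact; last exact: segment_compact.
  by apply: continuous_in_subspaceT => x; rewrite inE; exact: cu.
have [M [_ MA]] := compact_bounded cA.
exists (M + 1) => x xab; apply: MA; first by rewrite ltrDl.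
by exists x.
Qed.

End Bounds.

(** * Uniqueness for ordinary differential equations *)

Section Uniqueness.
Context {R : realType}.

(** The product of [W] with [expR (- K x)] is nonincreasing.  No sign condition
is put on [K] or [W], so that the lemma also applies to [- W] with [- K], which
is how it propagates information backwards in time. *)
Lemma gronwall (W dW : R -> R) (K a b : R) : a <= b ->
  (forall x, x \in `[a, b]%R -> is_derive x (1 : R) W (dW x)) ->
  (forall x, x \in `[a, b]%R -> dW x <= K * W x) ->
  W b <= W a * expR (K * (b - a)).
Proof.
move=> ab dWE dWK.
(* The integrating factor, normalized to 1 at [a]. *)
pose G x := W x * expR (- (K * (x - a))).
have dG x : x \in `[a, b]%R -> is_derive x (1 : R) G
    ((dW x - K * W x) * expR (- (K * (x - a)))).
  move=> xab; have ? := dWE x xab.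
  pose h (x : R) := - (K * (x - a)).
  have dh : is_derive x (1 : R) h (- K).
    have -> : h = (fun x => (- K) *: (x - a)).
      by apply/funext => z; rewrite /h -mulNr.
    by apply: is_derive_eq; rewrite subr0 [LHS]mulr1.
  have dE : is_derive x (1 : R) (expR \o h) (- K * expR (h x)).
    by apply: is_derive_eq; rewrite mulrC.
  have -> : G = W * (expR \o h) by [].
  by apply: is_derive_eq; rewrite /GRing.scale/= -/(h x); ring.
have : G b <= G a.
  apply: (@ler0_derive1_le_cc _ G a b) => //; rewrite ?in_itv/= ?lexx ?ab//.
  - by move=> x xab; have [] := dG x (subset_itv_oo_cc xab).
  - move=> x xab; rewrite derive1E; have xab' := subset_itv_oo_cc xab.
    have [_ ->] := dG x xab'.
    by rewrite pmulr_lle0 ?expR_gt0// subr_le0 dWK.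
  - apply: continuous_in_subspaceT => x; rewrite inE => xab.
    exact: is_derive_continuous (dG x xab).
rewrite /G subrr mulr0 oppr0 expR0 mulr1 expRN.
by rewrite ler_pdivrMr ?expR_gt0.
Qed.

Lemma gronwall0 (W dW : R -> R) (K a b : R) : a <= b ->
  (forall x, x \in `[a, b]%R -> is_derive x (1 : R) W (dW x)) ->
  (forall x, x \in `[a, b]%R -> `|dW x| <= K * W x) ->
  (forall x, 0 <= W x) ->
  W a = 0 <-> W b = 0.
Proof.
move=> ab dWE dWK W0; split=> W_eq0; apply/eqP; rewrite eq_le W0 andbT.
  have := gronwall ab dWE (K := K); rewrite W_eq0 mul0r; apply=> x xab.
  exact: le_trans (ler_norm _) (dWK x xab).
have := @gronwall (fun x => - W x) (fun x => - dW x) (- K) a b ab.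
rewrite W_eq0 oppr0 mulNr oppr_ge0 pmulr_lle0 ?expR_gt0//; apply => x xab.
  by have ? := dWE x xab; apply: is_deriveN.
by rewrite [leRHS]mulrNN (le_trans (ler_norm _))// normrN dWK.
Qed.

(** The squared Euclidean distance [W] of two solutions satisfies
[`|W'| <= K * W]: both solutions stay in a common ball, on which [V] is
Lipschitz.  The equivalence covers both directions of time. *)
Lemma ode_unique_segment n (V : 'rV[R]_n -> 'rV[R]_n) (c : R -> R)
    (a b : R -> 'rV[R]_n) (lo hi : R) :
  (forall k, Ck 1 (fun x => V x 0 k)) -> lo <= hi ->
  (forall t, t \in `[lo, hi]%R -> {for t, continuous c}) ->
  (forall t, t \in `[lo, hi]%R -> is_derive t (1 : R) a (c t *: V (a t))) ->
  (forall t, t \in `[lo, hi]%R -> is_derive t (1 : R) b (c t *: V (b t))) ->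
  a lo = b lo <-> a hi = b hi.
Proof.
move=> VC lohi cc da db.
have [Ma aM] := bounded_segment (fun t h => is_derive_continuous (da t h)).
have [Mb bM] := bounded_segment (fun t h => is_derive_continuous (db t h)).
have [Mc cM] := bounded_segment cc.
have /choice[L L_P] k : exists L, 0 <= L /\ forall x y,
    `|x| <= Num.max Ma Mb -> `|y| <= Num.max Ma Mb ->
    `|V x 0 k - V y 0 k| <= L * `|x - y|.
  by have [L ? ?] := C1_lipschitz_ball (Num.max Ma Mb) (VC k); exists L.
pose W t := \sum_(k < n) (a t 0 k - b t 0 k) ^+ 2.
pose dW t := \sum_(k < n)
  2 * (a t 0 k - b t 0 k) * (c t * (V (a t) 0 k - V (b t) 0 k)).
have dWE t : t \in `[lo, hi]%R -> is_derive t (1 : R) W (dW t).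
  move=> tI; pose h k (s : R) := (a s 0 k - b s 0 k) ^+ 2.
  have -> : W = \sum_(k < n) h k by apply/funext => s; rewrite fct_sumE.
  apply: is_derive_sum => k.
  have dak := is_derive_coord k (da t tI).
  have dbk := is_derive_coord k (db t tI).
  have -> : h k = ((fun s => a s 0 k) - (fun s => b s 0 k)) ^+ 2.
    by apply/funext.
  by apply: is_derive_eq; rewrite !mxE /GRing.scale/= expr1 mulr_natl; ring.
have WE t : W t = \sum_(k < n) (a t - b t) 0 k ^+ 2.
  by apply: eq_bigr => k _; rewrite !mxE.
have W_ge0 t : 0 <= W t by apply: sumr_ge0 => k _; rewrite sqr_ge0.
have W0 t : W t = 0 <-> a t = b t.
  split=> [Wt0|abt]; last by rewrite /W abt big1// => k _; rewrite subrr expr0n.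
  apply/subr0_eq/normr0_eq0/eqP; rewrite -sqrf_eq0 eq_le sqr_ge0 andbT.
  by rewrite (le_trans (ler_sqr_norm_sum_sqr _))// -WE Wt0.
rewrite -!W0.
apply: (@gronwall0 W dW (\sum_(k < n) 2 * Mc * L k) lo hi) => // t tI.
rewrite (le_trans (ler_norm_sum _ _ _))// mulr_suml ler_sum// => k _.
have aMM : `|a t| <= Num.max Ma Mb by rewrite le_max aM.
have bMM : `|b t| <= Num.max Ma Mb by rewrite le_max bM// orbT.
have LV := (L_P k).2 _ _ aMM bMM.
have abk : `|a t 0 k - b t 0 k| <= `|a t - b t|.
  by have := ler_coord_norm (a t - b t) k; rewrite !mxE.
have := ler_sqr_norm_sum_sqr (a t - b t); rewrite -WE => dWt.
have L0 := (L_P k).1; have ct := cM t tI.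
have Mc0 : 0 <= Mc := le_trans (normr_ge0 _) ct.
rewrite !normrM (@ger0_norm _ 2)//.
apply: (@le_trans _ _ (2 * `|a t - b t| * (Mc * (L k * `|a t - b t|)))).
  by rewrite ler_pM ?mulr_ge0//; [rewrite ler_wpM2l | rewrite ler_pM].
rewrite [leLHS](_ : _ = 2 * Mc * L k * `|a t - b t| ^+ 2); last by ring.
by rewrite ler_wpM2l// !mulr_ge0.
Qed.

Lemma ode_unique n (V : 'rV[R]_n -> 'rV[R]_n) (c : R -> R)
    (a b : R -> 'rV[R]_n) (J : set R) (t0 : R) :
  (forall k, Ck 1 (fun x => V x 0 k)) -> is_interval J -> J t0 ->
  (forall t, J t -> {for t, continuous c}) ->
  (forall t, J t -> is_derive t (1 : R) a (c t *: V (a t))) ->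
  (forall t, J t -> is_derive t (1 : R) b (c t *: V (b t))) ->
  a t0 = b t0 -> forall t, J t -> a t = b t.
Proof.
move=> VC itvJ Jt0 cc da db ab0 t Jt.
have [t0t|/ltW tt0] := leP t0 t.
  have JI s : s \in `[t0, t]%R -> J s by rewrite in_itv/=; exact: itvJ.
  by apply: (ode_unique_segment VC t0t _ _ _).1 ab0 => s /JI; auto.
have JI s : s \in `[t, t0]%R -> J s by rewrite in_itv/=; exact: itvJ.
by apply: (ode_unique_segment VC tt0 _ _ _).2 ab0 => s /JI; auto.
Qed.

Lemma C1_grad_coord n (F : 'rV[R]_n -> R) k : smooth F ->
  Ck 1 (fun x => grad F x 0 k).
Proof.
(* The partial derivative of a C^2 function is C^1. *)
move=> /(_ 2%N)[_ /(_ (delta_mx 0 k))].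
by have -> : (fun x => grad F x 0 k) = 'D_(delta_mx 0 k) F
  by apply/funext => x; rewrite /grad mxE.
Qed.

(** A gradient curve that met a stationary point would coincide with the
constant solution there. *)
Lemma gradient_curve_nonstationary n (F : 'rV[R]_n -> R) x gamma :
  smooth F -> gradient_curve F x gamma -> ~ stationary F x ->
  forall s, grad F (gamma s) <> 0.
Proof.
move=> sF [g0 dg] nst s gs0; apply: nst; rewrite /stationary -g0 -[RHS]gs0.
congr grad.
apply: (@ode_unique n (grad F) (cst 1) gamma (cst (gamma s)) setT s) => //.
- by move=> k; exact: C1_grad_coord.
- by move=> t _; exact: cvg_cst.
- by move=> t _; rewrite scale1r.
- by move=> t _; rewrite /cst gs0 scaler0; exact: is_derive_cst.
Qed.

End Uniqueness.

(** * Integrals with a variable endpoint *)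

Section OrientedIntegral.
Context {R : realType}.

(** A two-point neighbourhood: the fundamental theorem of calculus needs an
integration segment that extends beyond the points of interest on both sides. *)
Lemma open_interval_slack (J : set R) x y : open J -> J x -> J y ->
  exists lo hi, [/\ J lo, J hi, lo < x < hi & lo < y < hi].
Proof.
move=> oJ; have slack z : J z -> exists2 e, 0 < e & J (z - e) /\ J (z + e).
  move=> Jz; have : nbhs z J by exact: open_nbhs_nbhs.
  move=> /nbhs_ballP[e /= e0 zeJ]; exists (e / 2); first by rewrite divr_gt0.
  have e2 : `|e / 2| < e.
    by rewrite ger0_norm ?divr_ge0 ?(ltW e0)//; lra.
  by split; apply: zeJ; rewrite -ball_normE/= /ball_/= ?opprD ?opprK addrA subrr ?sub0r
    ?add0r ?normrN.
move=> Jx Jy; wlog xy : x y Jx Jy / x <= y.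
  move=> H; have [/H|/ltW/H] := leP x y; first exact.
  by move=> /(_ Jy Jx)[lo [hi [? ? ? ?]]]; exists lo, hi.
have [e e0 [Jl _]] := slack x Jx; have [d d0 [_ Jh]] := slack y Jy.
by exists (x - e), (y + d); split => //; apply/andP; split; lra.
Qed.

(** On a segment [`[lo, hi]] whose interior contains [a] and [x], the oriented
integral is [F z - F a] for the primitive [F] based at [lo], whatever the order
of [a] and [z]; this removes the case distinction before differentiating. *)
Lemma is_derive_oriented_integral (J : set R) (k : R -> R) a x :
  open J -> is_interval J -> J a -> J x ->
  (forall y, J y -> {for y, continuous k}) ->
  is_derive x (1 : R) (fun z => oriented_integral a z k) (k x).
Proof.
move=> oJ iJ Ja Jx ck.
have [lo [hi [Jlo Jhi /andP[loa ahi] /andP[lox xhi]]]] := open_interval_slack oJ Ja Jx.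
have kint l h : lo <= l -> h <= hi ->
    (@lebesgue_measure R).-integrable `[l, h] (EFin \o k).
  move=> lol hhi; apply: continuous_compact_integrable; first exact: segment_compact.
  apply: continuous_in_subspaceT => z; rewrite inE/= in_itv/= => /andP[lz zh].
  by apply: ck; apply: (iJ lo hi) => //; rewrite (le_trans lol)//= (le_trans zh).
pose F z := \int[lebesgue_measure]_(s in `[lo, z]) k s.
have split_int u v : lo <= u -> u <= v -> v <= hi ->
    \int[lebesgue_measure]_(s in `[u, v]) k s = F v - F u.
  move=> lou uv vhi; rewrite /F Rintegral_itvB ?bnd_simp//; last exact: kint.
  rewrite Rintegral_itv_obnd_cbnd//.
  by apply: integrableS (kint u v lou vhi) => //; exact: subset_itv_oc_cc.
have dF : is_derive x (1 : R) F (k x).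
  have [dF1 dF2] := continuous_FTC1_closed xhi (kint lo hi (lexx _) (lexx _)) lox (ck x Jx).
  by apply: (DeriveDef dF1); rewrite -derive1E.
have dFa : is_derive x (1 : R) (F - cst (F a)) (k x).
  by apply: is_derive_eq; rewrite subr0.
apply: near_eq_is_derive dFa; near=> z.
have /andP[loz zhi] : lo < z < hi.
  by apply/andP; split; near: z; [exact: lt_nbhsr | exact: lt_nbhsl].
rewrite -[LHS]/(F z - F a) /oriented_integral.
have [az|/ltW za] := leP a z; first by rewrite split_int ?(ltW loa) ?(ltW zhi).
by rewrite split_int ?(ltW loz) ?(ltW ahi)// opprB.
Unshelve. all: by end_near. Qed.

Lemma oriented_integral_refl (a : R) k : oriented_integral a a k = 0.
Proof. by rewrite /oriented_integral lexx set_itv1 Rintegral_set1. Qed.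

End OrientedIntegral.

(** * Orbits of a gradient flow and the energy of one player *)

Section Orbit.
Context {R : realType} {n : nat}.
Variables (F : 'rV[R]_n -> R) (x0 : 'rV[R]_n) (gamma : R -> 'rV[R]_n).
Hypotheses (sF : smooth F) (gammaP : gradient_curve F x0 gamma).
Hypothesis x0P : ~ stationary F x0.

Lemma sqr_enorm (v : 'rV[R]_n) : enorm v ^+ 2 = \sum_(k < n) v 0 k ^+ 2.
Proof. by rewrite sqr_sqrtr// sumr_ge0// => k _; rewrite sqr_ge0. Qed.

Lemma sqr_enorm_gt0 (v : 'rV[R]_n) : v <> 0 -> 0 < enorm v ^+ 2.
Proof.
move=> /eqP v0; rewrite sqr_enorm (lt_le_trans _ (ler_sqr_norm_sum_sqr v))//.
by rewrite exprn_gt0// normr_gt0.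
Qed.

Lemma smooth_differentiable x : differentiable F x.
Proof. by have [dF _] := sF 1%N; exact: dF. Qed.

Lemma continuous_grad_coord k : continuous (fun x => grad F x 0 k).
Proof.
by move=> x; have [d _] := C1_grad_coord k sF; exact: differentiable_continuous.
Qed.

(** Chain rule along a curve that follows the gradient at an arbitrary signed
speed: the orbit itself and the trajectories of both players are instances. *)
Lemma is_derive_along_flow (a : R -> 'rV[R]_n) c t :
  is_derive t (1 : R) a (c *: grad F (a t)) ->
  is_derive t (1 : R) (fun s => F (a s)) (c * enorm (grad F (a t)) ^+ 2).
Proof.
move=> da; have := is_derive_comp_grad (smooth_differentiable (a t)) da.
congr is_derive; rewrite sqr_enorm mulr_sumr; apply: eq_bigr => k _.
by rewrite !mxE mulrCA expr2.
Qed.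

Let h s := F (gamma s).

Lemma grad_orbit_neq0 s : grad F (gamma s) <> 0.
Proof. exact: (gradient_curve_nonstationary sF gammaP). Qed.

Lemma is_derive_orbit s :
  is_derive s (1 : R) h (enorm (grad F (gamma s)) ^+ 2).
Proof.
rewrite -[X in is_derive _ _ _ X]mul1r; apply: is_derive_along_flow.
by rewrite scale1r; exact: gammaP.2.
Qed.

Lemma continuous_orbit : continuous h.
Proof. by move=> s; exact: is_derive_continuous (is_derive_orbit s). Qed.

Lemma orbit_increasing a b : a < b -> h a < h b.
Proof.
move=> ab; have [|s _ hE] := MVT ab (fun s _ => is_derive_orbit s).
  by apply: continuous_subspaceT; exact: continuous_orbit.
rewrite -subr_gt0 hE mulr_gt0 ?subr_gt0//.
exact/sqr_enorm_gt0/grad_orbit_neq0.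
Qed.

Lemma orbit_injective : injective h.
Proof.
move=> a b hab; have [||//] := ltgtP a b => /orbit_increasing.
  by rewrite hab ltxx.
by rewrite hab ltxx.
Qed.

Let orbit_time z := get [set s : R | F (gamma s) = z].

Lemma orbit_timeK : cancel h orbit_time.
Proof.
by move=> s; apply: orbit_injective; apply: (@getPex _ [set r | h r = h s]); exists s.
Qed.

Lemma orbit_time_continuous z : orbit_values F gamma z -> {for z, continuous orbit_time}.
Proof.
move=> [s _ <-].
suff /nbhs_singleton : {near h s, continuous orbit_time} by [].
apply: (@near_can_continuous _ h orbit_time s); near=> y.
  exact: orbit_timeK.
exact: continuous_orbit.
Unshelve. all: by end_near. Qed.

(** Near a value of [h], the left inverse of the continuous injection [h] is also a
right inverse. *)
Lemma orbit_values_open : open (orbit_values F gamma).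
Proof.
rewrite openE => _ [s _ <-]; rewrite /interior/=.
have : \forall z \near h s, h (orbit_time z) = z.
  apply: (@near_continuous_can_sym _ h orbit_time s); near=> y.
    exact: continuous_orbit.
  exact: orbit_timeK.
by apply: filterS => z hz; exists (orbit_time z).
Unshelve. all: by end_near. Qed.

Lemma orbit_values_interval : is_interval (orbit_values F gamma).
Proof.
apply/connected_intervalP; apply: connected_continuous_connected.
  exact/connected_intervalP.
by apply: continuous_subspaceT; exact: continuous_orbit.
Qed.

(** The integrand depends on [z] through the inverse of [F \o gamma], which is
continuous, and the denominator does not vanish on the orbit. *)
Lemma continuous_density (p z : R) : orbit_values F gamma z ->
  {for z, continuous (fun z : R => (z - p) /
        enorm (grad F (orbit_point F gamma z)) ^+ 2)}.
Proof.
move=> Iz; have [s _ hs] := Iz.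
have ct := orbit_time_continuous Iz.
have cg k : {for z, continuous (fun z => grad F (gamma (orbit_time z)) 0 k)}.
  apply: (@continuous_comp _ _ _ orbit_time (fun s => grad F (gamma s) 0 k)) => //.
  apply: (@continuous_comp _ _ _ gamma (fun x => grad F x 0 k)).
    exact: is_derive_continuous (gammaP.2 _).
  exact: continuous_grad_coord.
apply: continuousM; first by apply: continuousB; [exact: cvg_id|exact: cvg_cst].
apply: continuousV.
  by rewrite gt_eqF//; exact/sqr_enorm_gt0/grad_orbit_neq0.
have -> : (fun z => enorm (grad F (orbit_point F gamma z)) ^+ 2) =
    (fun z => \sum_(k < n) grad F (gamma (orbit_time z)) 0 k ^+ 2).
  by apply/funext => y; rewrite sqr_enorm.
apply: cvg_big => [|k _]; first exact: add_continuous.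
exact: (continuous_comp (cg k) (@exprn_continuous _ 2 _)).
Qed.

Variables (J : set R) (theta : R -> 'rV[R]_n) (c : R -> R).
Hypotheses (oJ : open J) (iJ : is_interval J) (J0 : J 0) (theta0 : theta 0 = x0).
Hypothesis cc : forall t, J t -> {for t, continuous c}.
Hypothesis dtheta :
  forall t, J t -> is_derive t (1 : R) theta (c t *: grad F (theta t)).

(** The composition of [gamma] with the primitive of [c] solves the equation of
[theta], so the two agree by uniqueness. *)
Lemma theta_on_orbit t : J t -> theta t = gamma (oriented_integral 0 t c).
Proof.
move: t; apply: (@ode_unique _ n (grad F) c theta
  (gamma \o oriented_integral 0 ^~ c) J 0) => //.
- by move=> k; exact: C1_grad_coord.
- move=> t Jt; apply: is_derive_comp_curve; first exact: gammaP.2.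
  exact: is_derive_oriented_integral Jt cc.
- by rewrite /= oriented_integral_refl theta0 gammaP.1.
Qed.

(** The squared gradient norm produced by the chain rule cancels the denominator
of the integrand, because [orbit_point] recovers [theta t] from its value. *)
Lemma is_derive_player_energy (p t : R) : orbit_values F gamma p -> J t ->
  is_derive t (1 : R) (fun t => oriented_integral p (F (theta t))
     (fun z : R => (z - p) / enorm (grad F (orbit_point F gamma z)) ^+ 2))
   ((F (theta t) - p) * c t).
Proof.
move=> Ip Jt; have thetaE := theta_on_orbit Jt.
have It : orbit_values F gamma (F (theta t)) by rewrite thetaE; eexists.
have dE := is_derive_oriented_integral orbit_values_open orbit_values_interval
  Ip It (@continuous_density p).
have dF := is_derive_along_flow (dtheta Jt).
have := is_derive1_comp dE dF; congr is_derive.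
have -> : orbit_point F gamma (F (theta t)) = theta t.
  by rewrite thetaE /orbit_point -/(orbit_time _) orbit_timeK.
rewrite [c t * _]mulrC mulrA divfK// gt_eqF//.
by rewrite sqr_enorm_gt0// thetaE; exact: grad_orbit_neq0.
Qed.

End Orbit.

(** * Fully mixed equilibria *)

Section Nash.
Context {R : realType}.

(** The differences [a i - v] are nonnegative and have a vanishing sum with
positive weights, hence vanish. *)
Lemma weighted_min_const k (w a : 'I_k -> R) v :
  (forall i, 0 < w i) -> \sum_(i < k) w i = 1 -> (forall i, v <= a i) ->
  \sum_(i < k) w i * a i = v -> forall i, a i = v.
Proof.
move=> w0 w1 va wa i.
have /eqP : \sum_(i < k) w i * (a i - v) = 0.
  under eq_bigr do rewrite mulrBr.
  by rewrite sumrB wa -mulr_suml w1 mul1r subrr.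
rewrite psumr_eq0 => [/allP/(_ i (mem_index_enum i))|j _]; last first.
  by rewrite mulr_ge0 ?(ltW (w0 j))// subr_ge0.
by rewrite /= mulf_eq0 gt_eqF//= subr_eq0 => /eqP.
Qed.

Lemma payoff_rowsE N M (U : 'M[R]_(N, M)) x y :
  payoff U x y = \sum_(i < N) x i 0 * \sum_(j < M) U i j * y j 0.
Proof.
rewrite /payoff -mulmxA mxE; apply: eq_bigr => i _.
by rewrite !mxE.
Qed.

Lemma payoff_columnsE N M (U : 'M[R]_(N, M)) x y :
  payoff U x y = \sum_(j < M) y j 0 * \sum_(i < N) U i j * x i 0.
Proof.
rewrite /payoff mxE; apply: eq_bigr => j _.
by rewrite mulrC mxE; congr (_ * _); apply: eq_bigr => i _; rewrite mxE mulrC.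
Qed.

Lemma prob_vector_pure k (i : 'I_k) : prob_vector (delta_mx i 0 : 'cV[R]_k).
Proof.
split=> [j|]; first by rewrite mxE ler0n.
rewrite (bigD1 i)//= big1 ?mxE ?eqxx ?addr0// => j /negbTE ji.
by rewrite mxE ji.
Qed.

Lemma sum_pure k (i : 'I_k) (a : 'I_k -> R) :
  \sum_(j < k) (delta_mx i 0 : 'cV[R]_k) j 0 * a j = a i.
Proof.
rewrite (bigD1 i)//= big1 ?mxE ?eqxx ?mul1r ?addr0// => j /negbTE ji.
by rewrite mxE ji mul0r.
Qed.

(** The payoff of each pure strategy against the equilibrium is bounded by the
value on one side, and the value is the average of these payoffs with the
positive weights of the equilibrium. *)
Lemma fully_mixed_nash_const N M (U : 'M[R]_(N, M)) p q :
  fully_mixed_nash U p q ->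
  (forall i, \sum_(j < M) U i j * q j 0 = payoff U p q) /\
  (forall j, \sum_(i < N) U i j * p i 0 = payoff U p q).
Proof.
move=> [[[_ p1] p0] [[_ q1] q0] pmin qmax]; split.
  apply: (weighted_min_const p0 p1); last by rewrite -payoff_rowsE.
  by move=> i; have := pmin _ (prob_vector_pure i); rewrite [leRHS]payoff_rowsE sum_pure.
move=> j; apply: oppr_inj; move: j.
apply: (weighted_min_const q0 q1).
  move=> j; have := qmax _ (prob_vector_pure j).
  by rewrite [leLHS]payoff_columnsE sum_pure lerN2.
by under eq_bigr do rewrite mulrN; rewrite sumrN -payoff_columnsE.
Qed.

(** With [a], [b] the deviations of [x], [y] from equilibrium, the speeds become
[U b + (l + v)] and [U^T a + (mu + v)], so the first two sums contribute
[- B] and [B] for the bilinear form [B] in [a], [b]; the totals of [a] and [b]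
are the constraint defects multiplying the last two terms. *)
Lemma energy_cancel N M (U : 'M[R]_(N, M)) p q (x : 'I_N -> R) (y : 'I_M -> R)
    (l mu : R) : fully_mixed_nash U p q ->
  \sum_(i < N) (x i - p i 0) * - (\sum_(j < M) U i j * y j + l) +
  \sum_(j < M) (y j - q j 0) * (\sum_(i < N) U i j * x i + mu) +
  (l + payoff U p q) * (\sum_(i < N) x i - 1) +
  (mu + payoff U p q) * (- (\sum_(j < M) y j - 1)) = 0.
Proof.
move=> nash; have [Uq Up] := fully_mixed_nash_const nash.
set v := payoff U p q in Uq Up *.
have [[[_ p1] _] [[_ q1] _] _ _] := nash.
pose a i := x i - p i 0; pose b j := y j - q j 0.
have xE : \sum_(i < N) x i - 1 = \sum_(i < N) a i by rewrite sumrB p1.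
have yE : \sum_(j < M) y j - 1 = \sum_(j < M) b j by rewrite sumrB q1.
pose B := \sum_(i < N) \sum_(j < M) a i * U i j * b j.
have -> : \sum_(i < N) (x i - p i 0) * - (\sum_(j < M) U i j * y j + l) =
    - (B + (\sum_(i < N) a i) * (l + v)).
  rewrite mulr_suml -big_split -sumrN; apply: eq_bigr => i _ /=.
  rewrite -/(a i) mulrN; congr (- _).
  under [X in _ = X + _]eq_bigr do rewrite -mulrA mulrBr.
  rewrite -mulr_sumr sumrB Uq; ring.
have -> : \sum_(j < M) (y j - q j 0) * (\sum_(i < N) U i j * x i + mu) =
    B + (\sum_(j < M) b j) * (mu + v).
  rewrite /B exchange_big mulr_suml -big_split; apply: eq_bigr => j _ /=.
  rewrite -/(b j).
  under [X in _ = X + _]eq_bigr do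
    rewrite mulrC [a _ * _]mulrC mulrBr.
  rewrite -mulr_sumr sumrB Up; ring.
rewrite xE yE; ring.
Qed.

End Nash.

(** * Conservation of the energy *)

Theorem theorem5 (R : realType) (N M : nat)
    (n : 'I_N -> nat) (m : 'I_M -> nat)
    (f : forall i : 'I_N, 'rV[R]_(n i) -> R)
    (g : forall j : 'I_M, 'rV[R]_(m j) -> R)
    (U : 'M[R]_(N, M)) (p : 'cV[R]_N) (q : 'cV[R]_M)
    (theta0 : forall i : 'I_N, 'rV[R]_(n i))
    (phi0 : forall j : 'I_M, 'rV[R]_(m j))
    (lambda0 mu0 : R)
    (gamma : forall i : 'I_N, R -> 'rV[R]_(n i))
    (delta : forall j : 'I_M, R -> 'rV[R]_(m j))
    (f_ge0 : forall i x, 0 <= f i x)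
    (g_ge0 : forall j y, 0 <= g j y)
    (f_smooth : forall i, smooth (f i))
    (g_smooth : forall j, smooth (g j))
    (nash : fully_mixed_nash U p q)
    (f_flow : forall i, complete_gradient_flow (f i))
    (g_flow : forall j, complete_gradient_flow (g j))
    (gammaP : forall i, gradient_curve (f i) (theta0 i) (gamma i))
    (deltaP : forall j, gradient_curve (g j) (phi0 j) (delta j))
    (safe : safe_initialization f g p q theta0 phi0 gamma delta) :
  exists lambdas mus : R,
  forall (J : set R)
    (theta : forall i : 'I_N, R -> 'rV[R]_(n i))
    (phi : forall j : 'I_M, R -> 'rV[R]_(m j))
    (lambda mu : R -> R),
  open J -> is_interval J -> J 0 ->
  (forall i, theta i 0 = theta0 i) -> (forall j, phi j 0 = phi0 j) ->
  lambda 0 = lambda0 -> mu 0 = mu0 ->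
  gda_solution f g U J theta phi lambda mu ->
  forall s t : R, J s -> J t ->
    energy f g p q gamma delta lambdas mus theta phi lambda mu s =
    energy f g p q gamma delta lambdas mus theta phi lambda mu t.
Proof.
have [thetans phins p_orb q_orb] := safe.
(* The values at which the multipliers balance the equilibrium payoffs, so that
   all the speeds vanish at equilibrium. *)
exists (- payoff U p q), (- payoff U p q).
move=> J theta phi lambda mu oJ iJ J0 theta00 phi00 _ _ sol.
apply: is_derive0_constant => // t Jt.
have dtheta i s : J s -> is_derive s (1 : R) (theta i)
    (- (\sum_(j < M) U i j * g j (phi j s) + lambda s) *: grad (f i) (theta i s)).
  by move=> Js; have [+ _ _ _] := sol s Js => /(_ i); rewrite scaleNr.
have dphi j s : J s -> is_derive s (1 : R) (phi j)
    ((\sum_(i < N) U i j * f i (theta i s) + mu s) *: grad (g j) (phi j s)).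
  by move=> Js; have [_ + _ _] := sol s Js.
have dmu s : J s -> is_derive s (1 : R) mu (- (\sum_(j < M) g j (phi j s) - 1)).
  by move=> Js; have [_ _ + _] := sol s Js.
have dlambda s : J s -> is_derive s (1 : R) lambda (\sum_(i < N) f i (theta i s) - 1).
  by move=> Js; have [_ _ _ +] := sol s Js.
have ctheta i s : J s -> {for s, continuous (fun r => f i (theta i r))}.
  move=> Js.
  exact: is_derive_continuous (is_derive_along_flow (f_smooth i) (dtheta i s Js)).
have cphi j s : J s -> {for s, continuous (fun r => g j (phi j r))}.
  move=> Js.
  exact: is_derive_continuous (is_derive_along_flow (g_smooth j) (dphi j s Js)).
have dEf i := is_derive_player_energy (f_smooth i) (gammaP i) (thetans i)
  oJ iJ J0 (theta00 i) (fun s Js => continuousN (continuous_affine_sum (u := U i)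
    (fun j => cphi j s Js) (is_derive_continuous (dlambda s Js))))
  (dtheta i) (p_orb i) Jt.
have dEg j := is_derive_player_energy (g_smooth j) (deltaP j) (phins j)
  oJ iJ J0 (phi00 j) (fun s Js => continuous_affine_sum (u := U^~ j)
    (fun i => ctheta i s Js) (is_derive_continuous (dmu s Js)))
  (dphi j) (q_orb j) Jt.
have dE_mult (a : R) (l : R -> R) dl : is_derive t (1 : R) l dl ->
    is_derive t (1 : R) (fun s => oriented_integral a (l s) (fun z => z - a))
      ((l t - a) * dl).
  move=> dlt.
  apply: (@is_derive1_comp _ (fun z => oriented_integral a z (fun z => z - a))).
  apply: (@is_derive_oriented_integral _ setT (fun z => z - a)) => //.
    exact: openT.
  by move=> y _; apply: continuousB; [exact: cvg_id | exact: cvg_cst].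
have := is_deriveD (is_deriveD (is_deriveD (is_derive_fun_sum dEf)
  (is_derive_fun_sum dEg)) (dE_mult (- payoff U p q) _ _ (dlambda t Jt)))
  (dE_mult (- payoff U p q) _ _ (dmu t Jt)).
by congr is_derive; rewrite !opprK energy_cancel.
Qed.
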